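(* Let $n,k$ be integers such that $k\geq 2$ and $n\geq 5k+2$, and let $G$ be a tripartite graph with parts $A,B,C$ such that $|A|=|B|=|C|=n$. Let $\tau_k(n)$ denote the positive solution of the equation $nx^2+(n+1-k)x-n=0$. If $d(G)>\tau_k(n)$, then $G$ contains $k$ vertex-disjoint triangles.
   Context: For a tripartite graph $G$ with parts $V_1,V_2,V_3$, $G[V_i,V_j]$ denotes the bipartite graph consisting of the edges of $G$ between $V_i$ and $V_j$, and the bipartite density of $G$ is $$d(G):=\min_{1\leq i<j\leq 3}\frac{|E(G[V_i,V_j])|}{|V_i|\cdot|V_j|}.$$ *)

(* Defs.v *)
From HB Require Import structures.
From mathcomp Require Import all_boot all_order all_algebra.

Set Implicit Arguments.
Unset Strict Implicit.
Unset Printing Implicit Defensive.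

Import Order.TTheory GRing.Theory Num.Theory.
Local Open Scope ring_scope.

Record sgraph (T : finType) := SGraph {
  adj :> rel T;
  adj_sym : symmetric adj;
  adj_irr : irreflexive adj
}.

Definition independent (T : finType) (G : sgraph T) (S : {set T}) : Prop :=
  forall x y, x \in S -> y \in S -> ~~ G x y.

Definition tripartite (T : finType) (G : sgraph T) (A B C : {set T}) : Prop :=
  [/\ A :|: B :|: C = [set: T],
      [/\ [disjoint A & B], [disjoint A & C] & [disjoint B & C]]
    & [/\ independent G A, independent G B & independent G C]].

(* For disjoint U and W, every edge between them is counted exactly once:
   it is recorded as the pair whose first component is its endpoint in U. *)
Definition edges_between (T : finType) (G : sgraph T) (U W : {set T}) :
    {set T * T} :=
  [set p in setX U W | G p.1 p.2].

Definition pair_density (R : rcfType) (T : finType) (G : sgraph T)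
    (U W : {set T}) : R :=
  #|edges_between G U W|%:R / (#|U|%:R * #|W|%:R).

Definition bip_density (R : rcfType) (T : finType) (G : sgraph T)
    (A B C : {set T}) : R :=
  Num.min (pair_density R G A B)
          (Num.min (pair_density R G A C) (pair_density R G B C)).

(* The product of the roots is -1, so exactly one tau satisfies this
   when n > 0. The subtraction n + 1 - k takes place in R. *)
Definition is_tau (R : rcfType) (k n : nat) (tau : R) : Prop :=
  0 < tau /\ n%:R * tau ^+ 2 + (n%:R + 1 - k%:R) * tau - n%:R = 0.

Definition triangle (T : finType) (G : sgraph T) (t : {set T}) : Prop :=
  #|t| = 3 /\ forall x y, x \in t -> y \in t -> x != y -> G x y.

Definition has_disjoint_triangles (T : finType) (G : sgraph T) (k : nat) :
    Prop :=
  exists P : {set {set T}},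
    [/\ #|P| = k, trivIset P & forall t, t \in P -> triangle G t].

(* Main.v *)
Require Import Defs.
From HB Require Import structures.
From mathcomp Require Import all_boot all_order all_algebra.
From mathcomp Require Import zify ring lra.

Set Implicit Arguments.
Unset Strict Implicit.
Unset Printing Implicit Defensive.

Import Order.TTheory GRing.Theory Num.Theory.
Local Open Scope ring_scope.

(* Let s = k - 1 and let d be the bipartite density. For one triangle, the tool
   is the density theorem of Bondy, Shen, Thomasse and Thomasse: if
   al * be + ga > 1 for the densities of the three pairs, in every order, then
   there is a triangle.

   For k triangles, repeatedly remove a rich vertex, one whose triangles cannot
   all be hit by a set with few vertices in each part: such a vertex extends
   any family of disjoint triangles found in the rest. If s rich vertices are
   removed, the density theorem applies to what is left. If the process stops
   with j > 0 removals to go, take a maximum family of disjoint triangles,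
   assumed to have at most j members. In each member at most one vertex needs
   more than two edges deleted in order to lie in no triangle with the
   uncovered vertices, since otherwise two of them could be exchanged for the
   member. Deleting those edges and the edges between the remaining covered
   vertices destroys all triangles and costs at most (5 j^2 + 8 j) / 4 edges
   per pair of parts, too few to leave the range of the density theorem when
   n >= 5 s + 7. *)

(** * The density theorem for one triangle *)

Section TwoTypes.
Variable R : realFieldType.

(* For fixed l, c, t and b, the constraints get weaker as s grows: the first one
   forces c < l * t and b < (1 - l) * s, hence (b + l * s) * t <= 1 - U with
   U = b * c + s * c + b * t, and this is what makes the right-hand side of the
   second one increase. So one may assume s = 1 - b, and likewise t = 1 - c. *)
Lemma two_types_extend (b s c t l : R) :
  0 <= b -> 0 <= s -> b + s <= 1 -> 0 <= c -> 0 <= t -> c + t <= 1 ->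
  0 < l -> l < 1 ->
  (1 - l) * s * c + l * b * t < l * (1 - l) * s * t ->
  1 < (b + l * s) * (1 - (b * c + s * c + b * t)) + (c + (1 - l) * t) ->
  1 < (c + (1 - l) * t) * (1 - (b * c + s * c + b * t)) + (b + l * s) ->
  let s' := 1 - b in
  [/\ (1 - l) * s' * c + l * b * t < l * (1 - l) * s' * t,
  1 < (b + l * s') * (1 - (b * c + s' * c + b * t)) + (c + (1 - l) * t) &
  1 < (c + (1 - l) * t) * (1 - (b * c + s' * c + b * t)) + (b + l * s')].
Proof.
move=> b0 s0 bs c0 t0 ct l0 l1 h1 h2 h3 s'.
set e := 1 - b - s.
have e0 : 0 <= e by rewrite /e; lra.
have s'E : s' = s + e by rewrite /s' /e; ring.
have bt0 : 0 <= b * t by exact: mulr_ge0.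
have sc0 : 0 <= s * c by exact: mulr_ge0.
have st0 : 0 < s * t.
  have /andP [_ h] : (0 <= l * (b * t)) && (0 <= (1 - l) * (s * c)).
    by rewrite !mulr_ge0 //; lra.
  have : 0 < l * (1 - l) * (s * t) by nra.
  by rewrite pmulr_rgt0 // mulr_gt0 //; lra.
have sp : 0 < s by rewrite lt_neqAle s0 andbT; apply/eqP=> h; rewrite -h mul0r ltxx in st0.
have tp : 0 < t by rewrite lt_neqAle t0 andbT; apply/eqP=> h; rewrite -h mulr0 ltxx in st0.
have bl : b < (1 - l) * s.
  have : 0 < (l * t) * ((1 - l) * s - b).
    have : 0 <= (1 - l) * (s * c) by rewrite mulr_ge0 //; lra.
    nra.
  by rewrite pmulr_rgt0 ?mulr_gt0 // subr_gt0.
have cl : c < l * t.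
  have : 0 < ((1 - l) * s) * (l * t - c).
    have : 0 <= l * (b * t) by rewrite mulr_ge0 //; lra.
    nra.
  by rewrite pmulr_rgt0 ?mulr_gt0 // ?subr_gt0 //; lra.
have h1' : (1 - l) * s' * c + l * b * t < l * (1 - l) * s' * t.
  have : 0 <= e * ((1 - l) * (l * t - c)) by rewrite !mulr_ge0 //; lra.
  rewrite s'E; nra.
have bl' : b <= (1 - l) * s' by rewrite s'E; have := mulr_ge0 e0 (_ : 0 <= 1 - l); lra.
set al := b + l * s'.
set be := c + (1 - l) * t.
set U := b * c + s' * c + b * t.
have al0 : 0 <= al by rewrite addr_ge0 // mulr_ge0 //; rewrite /s'; lra.
have Uab : U <= al * be.
  by rewrite /U /al /be; nra.
have al1 : al * (2 - l) <= 1.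
  have : 0 <= ((1 - l) * s' - b) * (1 - l) by rewrite mulr_ge0 //; lra.
  have -> : al * (2 - l) = b + s' - ((1 - l) * s' - b) * (1 - l) by rewrite /al; ring.
  rewrite /s'; lra.
have beT : be + t <= 2 - l.
  by have := mulr_ge0 (_ : 0 <= 1 - l) (_ : 0 <= 1 - t); rewrite /be; nra.
have key : al * t <= 1 - U.
  have : al * (be + t) <= al * (2 - l) by rewrite ler_wpM2l.
  nra.
have g1 : al * c <= l * (1 - U).
  have : al * c <= al * (l * t) by rewrite ler_wpM2l // ltW.
  have : l * (al * t) <= l * (1 - U) by rewrite ler_wpM2l // ltW.
  nra.
split => //.
- have alE : b + l * s = al - l * e by rewrite /al s'E; ring.
  have UE : b * c + s * c + b * t = U - e * c by rewrite /U s'E; ring.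
  move: h2; rewrite alE UE.
  have : 0 <= e * (l * (1 - U) - al * c) by rewrite mulr_ge0 // subr_ge0.
  have : 0 <= e * e * (l * c) by rewrite !mulr_ge0 // ltW.
  rewrite -/be.
  move=> x1 x2 x3.
  have : al * (1 - U) - (al - l * e) * (1 - (U - e * c)) =
    e * (l * (1 - U) - al * c) + e * e * (l * c) by ring.
  lra.
- have alE : b + l * s = al - l * e by rewrite /al s'E; ring.
  have UE : b * c + s * c + b * t = U - e * c by rewrite /U s'E; ring.
  move: h3; rewrite alE UE -/be.
  have cb : be * c <= l.
    have t1 : t <= 1 by lra.
    have be1 : be <= 1.
      rewrite /be; have : 0 <= l * t by rewrite mulr_ge0 // ltW.
      lra.
    have : be * c <= 1 * c by rewrite ler_wpM2r.
    have : l * t <= l * 1 by rewrite ler_wpM2l // ltW.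
    lra.
  have : 0 <= e * (l - be * c) by rewrite mulr_ge0 // subr_ge0.
  move=> x1 x2.
  have : be * (1 - U) + al - (be * (1 - (U - e * c)) + (al - l * e)) = e * (l - be * c) by ring.
  lra.
Qed.

(** [two_types_extend] is used twice, the second time with the roles of B and C exchanged and
    [1 - l] for [l], to reach [s = 1 - b] and [t = 1 - c], where everything factors. *)
Lemma two_types_core (b s c t l : R) :
  0 <= b -> 0 <= s -> b + s <= 1 -> 0 <= c -> 0 <= t -> c + t <= 1 ->
  0 < l -> l < 1 ->
  (1 - l) * s * c + l * b * t < l * (1 - l) * s * t ->
  1 < (b + l * s) * (1 - (b * c + s * c + b * t)) + (c + (1 - l) * t) ->
  1 < (c + (1 - l) * t) * (1 - (b * c + s * c + b * t)) + (b + l * s) ->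
  False.
Proof.
move=> b0 s0 bs c0 t0 ct l0 l1 h1 h2 h3.
have [{}h1 {}h2 {}h3] := two_types_extend b0 s0 bs c0 t0 ct l0 l1 h1 h2 h3.
have [||||||||||| {}h1 {}h2 {}h3] := @two_types_extend c t b (1 - b) (1 - l) => //; try lra.
move: h1 h2 h3; set t' := 1 - c => h1 h2 h3.
have b1 : b <= 1 by lra.
have c1 : c <= 1 by lra.
(* Now [1 - U = (1 - b) * (1 - c)], so each density constraint becomes the positivity of a product.
   The last factors give [l < 1 - l] and [1 - l < l]. *)
have : 0 < c * (1 - b) * (l * (1 - c) - (1 - l)) by rewrite /t' in h2; nra.
have : 0 < b * (1 - c) * ((1 - l) * (1 - b) - l) by rewrite /t' in h3; nra.
move=> y1 y2.
have z1 : l < (1 - l) * (1 - b).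
  rewrite -subr_gt0; apply: contraTT y1; rewrite -!leNgt => h.
  by rewrite mulr_ge0_le0 // mulr_ge0 //; lra.
have z2 : (1 - l) < l * (1 - c).
  rewrite -subr_gt0; apply: contraTT y2; rewrite -!leNgt => h.
  by rewrite mulr_ge0_le0 // mulr_ge0 //; lra.
have : 0 <= (1 - l) * b by rewrite mulr_ge0 //; lra.
have : 0 <= l * c by rewrite mulr_ge0 //; lra.
lra.
Qed.

(* A is reduced to two vertices of weights l and 1 - l, with (b1, c1) and
   (b2, c2) the fractions of B and C they see; the edges between B and C avoid
   both products of neighbourhoods, whose union is smallest when they are
   nested, which gives the bound on ga. *)
Lemma two_types (b1 b2 c1 c2 l al be ga : R) :
  0 <= b2 <= b1 -> b1 <= 1 -> 0 <= c1 <= c2 -> c2 <= 1 -> 0 < l < 1 ->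
  0 <= al <= l * b1 + (1 - l) * b2 -> 0 <= be <= l * c1 + (1 - l) * c2 ->
  0 <= ga <= 1 - (b1 * c1 + b2 * c2 - b2 * c1) ->
  [/\ 1 < al * be + ga, 1 < al * ga + be & 1 < be * ga + al] -> False.
Proof.
move=> /andP[b20 b21] b11 /andP[c10 c12] c21 /andP[l0 l1].
move=> /andP[al0 al1] /andP[be0 be1] /andP[ga0 ga1] [h1 h2 h3].
set s := b1 - b2; set t := c2 - c1.
have aE : l * b1 + (1 - l) * b2 = b2 + l * s by rewrite /s; ring.
have bE : l * c1 + (1 - l) * c2 = c1 + (1 - l) * t by rewrite /t; ring.
have gE : 1 - (b1 * c1 + b2 * c2 - b2 * c1) = 1 - (b2 * c1 + s * c1 + b2 * t).
  by rewrite /s /t; ring.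
rewrite aE in al1; rewrite bE in be1; rewrite gE in ga1.
have m1 := ler_pM al0 be0 al1 be1.
have m2 := ler_pM al0 ga0 al1 ga1.
have m3 := ler_pM be0 ga0 be1 ga1.
apply: (@two_types_core b2 s c1 t l); rewrite ?subr_ge0 //.
- by rewrite /s subrKC.
- by rewrite /t subrKC.
- have := lt_le_trans h1 (lerD m1 ga1).
  set u := b2; set v := c1; nra.
- exact: lt_le_trans h2 (lerD m2 be1).
- exact: lt_le_trans h3 (lerD m3 al1).
Qed.

(** The points [(x a, y a)] have their centroid at the origin. If none lies in the closed first
    quadrant, some segment between two of them meets the vertical axis at or above the origin, which
    is the sign of the determinant. Otherwise all determinants over [P] and [Q] would be negative;
    but their sum vanishes, since the sums over [P] and over [Q] are opposite. *)
Lemma dominating_pair (T : finType) (A : {set T}) (x y : T -> R) :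
  A != set0 -> \sum_(a in A) x a = 0 -> \sum_(a in A) y a = 0 ->
  (exists2 a, a \in A & (0 <= x a) && (0 <= y a)) \/
  exists i j, [/\ i \in A, j \in A, x j < 0 <= x i, y i < 0 &
     0 <= y j * x i - y i * x j].
Proof.
move=> A0 sx sy.
have [/exists_inP|] := boolP [exists a in A, (0 <= x a) && (0 <= y a)]; first by left.
rewrite negb_exists_in => /forall_inP nd; right.
pose P := [set a in A | 0 <= x a]; pose Q := [set a in A | x a < 0].
have split (f : T -> R) : \sum_(a in A) f a = \sum_(a in P) f a + \sum_(a in Q) f a.
  rewrite (bigID (fun a => 0 <= x a)) /=; congr (_ + _); apply: eq_bigl => a.
    by rewrite !inE.
  by rewrite !inE ltNge.
have yP a : a \in P -> y a < 0.
  by rewrite inE => /andP[aA xa]; have := nd a aA; rewrite xa /= -ltNge.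
have neg_sum (B : {set T}) (f : T -> R) : B != set0 ->
    (forall a, a \in B -> f a < 0) -> \sum_(a in B) f a < 0.
  case/set0Pn=> b bB fB; have {2}-> : 0 = \sum_(a in B) (0 : R) by rewrite big1.
  by apply: ltr_sum => //; apply/hasP; exists b; rewrite ?mem_index_enum.
have P0 : P != set0.
  apply/eqP => P0; suff : \sum_(a in A) x a < 0 by rewrite sx ltxx.
  apply: neg_sum => // a aA; rewrite ltNge; apply/negP => xa.
  by have := in_set0 a; rewrite -P0 inE aA xa.
have Q0 : Q != set0.
  apply/eqP => Q0; suff : \sum_(a in A) y a < 0 by rewrite sy ltxx.
  apply: neg_sum => // a aA; apply: yP; rewrite inE aA leNgt; apply/negP => xa.
  by have := in_set0 a; rewrite -Q0 inE aA xa.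
have [/exists_inP[i iP /exists_inP[j jQ h]]|] :=
  boolP [exists i in P, exists j in Q, 0 <= y j * x i - y i * x j].
  exists i, j; have yi := yP _ iP.
  by move: iP jQ; rewrite !inE => /andP[-> ->] /andP[-> ->].
rewrite negb_exists_in => /forall_inP h.
have : \sum_(i in P) \sum_(j in Q) (y j * x i - y i * x j) < 0.
  apply: (@neg_sum P) => // i iP; apply: neg_sum => // j jQ.
  by have := h i iP; rewrite negb_exists_in => /forall_inP /(_ _ jQ); rewrite -ltNge.
under eq_bigr => i _ do rewrite sumrB -mulr_suml -mulr_sumr.
rewrite sumrB -mulr_sumr -mulr_suml.
move: (sx) (sy); rewrite !split => ex ey.
have -> : \sum_(a in P) x a = - \sum_(a in Q) x a by lra.
have -> : \sum_(a in P) y a = - \sum_(a in Q) y a by lra.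
by rewrite mulrN mulNr subrr ltxx.
Qed.
End TwoTypes.

Section Density.
Variables (R : rcfType) (T : finType) (G : sgraph T).
Implicit Types A B C : {set T}.

Definition nbr (a : T) B := [set b in B | G a b].

Lemma card_setX_rel (e : rel T) A B :
  #|[set p in setX A B | e p.1 p.2]| = (\sum_(a in A) #|[set b in B | e a b]|)%N.
Proof.
rewrite -sum1_card (eq_bigl (fun p => (p.1 \in A) && ((p.2 \in B) && e p.1 p.2))).
  rewrite -(pair_big_dep (mem A) (fun a b => (b \in B) && e a b) (fun _ _ => 1%N)) /=.
  by apply: eq_bigr => a _; rewrite sum1dep_card.
by move=> p; rewrite !inE andbA.
Qed.

Lemma pair_density_ge0 A B : 0 <= pair_density R G A B.
Proof. by rewrite divr_ge0 ?mulr_ge0 ?ler0n. Qed.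

Lemma card_edges_le A B : (#|edges_between G A B| <= #|A| * #|B|)%N.
Proof. by rewrite -cardsX; apply/subset_leq_card/subsetP => p; rewrite inE => /andP[]. Qed.

Lemma pair_density_le1 A B : pair_density R G A B <= 1.
Proof.
rewrite /pair_density -natrM; case: (posnP (#|A| * #|B|)%N) => [->|h].
  by rewrite invr0 mulr0 ler01.
by rewrite ler_pdivrMr ?ltr0n // mul1r ler_nat card_edges_le.
Qed.

Definition frac (A B : {set T}) : R := #|A|%:R / #|B|%:R.

Lemma frac_ge0 A B : 0 <= frac A B.
Proof. by rewrite divr_ge0 ?ler0n. Qed.

Lemma frac_le1 A B : A \subset B -> frac A B <= 1.
Proof.
move=> AB; rewrite /frac; case: (posnP #|B|) => [->|h]; first by rewrite invr0 mulr0 ler01.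
by rewrite ler_pdivrMr ?ltr0n // mul1r ler_nat subset_leq_card.
Qed.

Lemma sum_frac_nbr A B : (0 < #|A|)%N -> (0 < #|B|)%N ->
  \sum_(a in A) (frac (nbr a B) B - pair_density R G A B) = 0.
Proof.
move=> A0 B0; rewrite sumrB -mulr_suml -natr_sum -card_setX_rel sumr_const /pair_density.
rewrite -mulr_natl; apply/eqP; rewrite subr_eq0; apply/eqP; field.
by rewrite !pnatr_eq0 -!lt0n A0 B0.
Qed.

(** Inclusion-exclusion, the intersection of the two products lying in [setX X2 Y1]. This yields the
    bound on [ga] in [two_types]. *)
Lemma card_setX_union (X1 X2 Y1 Y2 : {set T}) :
  (#|X1| * #|Y1| + #|X2| * #|Y2| <=
   #|setX X1 Y1 :|: setX X2 Y2| + #|X2| * #|Y1|)%N.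
Proof.
rewrite -!cardsX -cardsUI leq_add2l subset_leq_card //.
by apply/subsetP => p; rewrite !inE => /andP[/andP[_ ->] /andP[-> _]].
Qed.

(** Without such a triangle, no edge between B and C lies in the product of the neighbourhoods of a
    vertex of A. If one vertex sees at least the average fraction of both B and C, then
    [ga <= 1 - al * be]. Otherwise [dominating_pair] supplies two vertices to which [two_types]
    applies. *)
Lemma dense_triangle A B C :
  let al := pair_density R G A B in
  let be := pair_density R G A C in
  let ga := pair_density R G B C in
  1 < al * be + ga -> 1 < al * ga + be -> 1 < be * ga + al ->
  exists a b c, [/\ a \in A, b \in B, c \in C & [/\ G a b, G a c & G b c]].
Proof.
move=> al be ga h1 h2 h3.
(* Division by 0 yields 0, so an empty part has density 0 to the others, and one hypothesis would
   then make the third density exceed 1. *)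
have pd0 U : pair_density R G set0 U = 0 by rewrite /pair_density cards0 mul0r invr0 mulr0.
have pd0' U : pair_density R G U set0 = 0 by rewrite /pair_density cards0 mulr0 invr0 mulr0.
have A0 : A != set0.
  apply: contraTneq h1 => A0; rewrite /al /be A0 !pd0 mul0r add0r -leNgt.
  exact: pair_density_le1.
have B0 : B != set0.
  apply: contraTneq h2 => B0; rewrite /al /ga B0 pd0 pd0' mul0r add0r -leNgt.
  exact: pair_density_le1.
have C0 : C != set0.
  apply: contraTneq h3 => C0; rewrite /be /ga C0 !pd0' mul0r add0r -leNgt.
  exact: pair_density_le1.
have [cA cB cC] : [/\ (0 < #|A|)%N, (0 < #|B|)%N & (0 < #|C|)%N] by rewrite !card_gt0.
pose x a := frac (nbr a B) B; pose y a := frac (nbr a C) C.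
have [/existsP[a /existsP[b /existsP[c /and3P[aA bB /and4P[cC' ab ac bc]]]]]|tf] :=
  boolP [exists a, exists b, exists c,
    [&& a \in A, b \in B & [&& c \in C, G a b, G a c & G b c]]].
  by exists a, b, c.
exfalso.
have disj a : a \in A -> [disjoint edges_between G B C & setX (nbr a B) (nbr a C)].
  move=> aA; rewrite -setI_eq0 -subset0; apply/subsetP => -[b c]; rewrite !inE /=.
  case/andP=> /andP[/andP[bB cC'] bc] /andP[/andP[_ ab] /andP[_ ac]].
  case/negP: tf; apply/existsP; exists a; apply/existsP; exists b; apply/existsP; exists c.
  by apply/and3P; split => //; apply/and4P.
have sub a : setX (nbr a B) (nbr a C) \subset setX B C.
  by apply/subsetP => p; rewrite !inE => /andP[/andP[-> _] /andP[-> _]].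
have miss (S : {set T * T}) (m : nat) : [disjoint edges_between G B C & S] ->
    S \subset setX B C -> (m <= #|S|)%N -> ga <= 1 - m%:R / (#|B|%:R * #|C|%:R).
  move=> dS sS mS; have p : 0 < #|B|%:R * #|C|%:R :> R by rewrite mulr_gt0 ?ltr0n.
  rewrite lerBrDr -mulrDl ler_pdivrMr // mul1r -natrD -natrM ler_nat -cardsX.
  apply: (@leq_trans (#|edges_between G B C| + #|S|)); first by rewrite leq_add2l.
  have := leq_card_setU (edges_between G B C) S; rewrite dS => /leqifP /eqP <-.
  apply: subset_leq_card; rewrite subUset sS andbT.
  by apply/subsetP => p'; rewrite inE => /andP[].
have fracM (X Y : {set T}) : frac X B * frac Y C = (#|X| * #|Y|)%:R / (#|B|%:R * #|C|%:R).
  by rewrite /frac natrM; field; rewrite !pnatr_eq0 -!lt0n cB cC.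
have ga_le := pair_density_ge0 B C; rewrite -/ga in ga_le.
have al_le := pair_density_ge0 A B; rewrite -/al in al_le.
have be_le := pair_density_ge0 A C; rewrite -/be in be_le.
have nsub a U : nbr a U \subset U by apply/subsetP => u; rewrite inE => /andP[].
case: (dominating_pair A0 (sum_frac_nbr cA cB) (sum_frac_nbr cA cC)).
  case=> a aA; rewrite !subr_ge0 => /andP[xa ya].
  have := miss _ _ (disj a aA) (sub a) (leqnn _).
  rewrite cardsX -fracM => g.
  have := ler_pM al_le be_le xa ya; rewrite -/al -/be => ?; lra.
case=> i [j [iA jA]]; rewrite -/al -/be -/(x i) -/(x j) -/(y i) -/(y j) => /andP[xj xi] yi h.
have d0 : 0 < x i - x j by lra.
(* The weight for which [i] and [j] together see exactly [al] of B; by the determinant condition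
   they then see at least [be] of C. *)
pose l := (al - x j) / (x i - x j).
have l0 : 0 < l by rewrite divr_gt0 //; lra.
have lE : l * (x i - x j) = al - x j by rewrite /l mulfVK // gt_eqF.
have l'E : (1 - l) * (x i - x j) = x i - al by rewrite mulrBl lE; lra.
have yc : be <= l * y i + (1 - l) * y j.
  have : 0 <= (x i - x j) * (l * (y i - be) + (1 - l) * (y j - be)).
    have -> : (x i - x j) * (l * (y i - be) + (1 - l) * (y j - be)) =
      (l * (x i - x j)) * (y i - be) + ((1 - l) * (x i - x j)) * (y j - be) by ring.
    rewrite lE l'E; lra.
  by rewrite pmulr_rge0 //; lra.
have l1 : l < 1.
  rewrite ltNge; apply/negP => l1.
  have : l = 1.
    apply/eqP; rewrite eq_le l1 andbT.
    have : 0 <= (1 - l) * (x i - x j) by rewrite l'E.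
    by rewrite pmulr_lge0 // subr_ge0.
  by move=> le; move: yc; rewrite le; lra.
have yij : y i <= y j.
  have : 0 < (1 - l) * (y j - be).
    have : 0 < l * (be - y i) by rewrite mulr_gt0 //; lra.
    lra.
  by rewrite pmulr_rgt0; lra.
have disU : [disjoint edges_between G B C
                    & setX (nbr i B) (nbr i C) :|: setX (nbr j B) (nbr j C)].
  by rewrite -setI_eq0 setIUr setU_eq0 !setI_eq0 !disj.
have subU : setX (nbr i B) (nbr i C) :|: setX (nbr j B) (nbr j C) \subset setX B C.
  by rewrite subUset !sub.
have gle : ga <= 1 - (x i * y i + x j * y j - x j * y i).
  apply: (le_trans (miss _ _ disU subU (leqnn _))).
  rewrite lerD2l lerN2 /x /y !fracM -mulrDl -mulrBl.
  rewrite ler_pM2r ?invr_gt0 ?mulr_gt0 ?ltr0n //.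
  by rewrite lerBlDr -!natrD ler_nat card_setX_union.
apply: (@two_types R (x i) (x j) (y i) (y j) l al be ga) => //.
all: rewrite ?frac_ge0 ?frac_le1 ?nsub ?l0 ?al_le ?be_le ?ga_le //=; lra.
Qed.
End Density.

(** * Families of disjoint triangles *)

Section Families.
Local Open Scope nat_scope.
Variables (T : finType) (f : T -> 'I_3).
Implicit Types (G : sgraph T) (V S t : {set T}) (P : {set {set T}}).

(** The three parts are encoded as colour classes, so that facts about one part or a pair of parts
    are stated once, for indices [i] and [j]. *)
Definition proper_coloring G := forall x y, G x y -> f x != f y.

Definition part V i := [set x in V | f x == i].

(** Non-edges are counted rather than edges: removing vertices never increases their number, and
    deletions simply add to it. *)
Definition nonedges G U W := [set p in setX U W | ~~ G p.1 p.2].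

Definition is_triangle G t :=
  (#|t| == 3) && [forall x in t, forall y in t, (x != y) ==> G x y].

Lemma is_triangleP G t : reflect (triangle G t) (is_triangle G t).
Proof.
apply: (iffP andP) => -[h1 h2]; split; try exact/eqP.
  by move=> x y xt yt xy; move/forall_inP/(_ x xt)/forall_inP/(_ y yt)/implyP: h2; apply.
by apply/forall_inP => x xt; apply/forall_inP => y yt; apply/implyP; exact: h2.
Qed.

Lemma is_triangle_set3 G x y z :
  G x y -> G x z -> G y z -> is_triangle G [set x; y; z].
Proof.
move=> xy xz yz; have ne a b : G a b -> a != b by apply: contraTneq => ->; rewrite adj_irr.
apply/andP; split.
  by rewrite -setUA cardsU1 cards2 !inE negb_or (ne _ _ xy) (ne _ _ xz) (ne _ _ yz).
apply/forall_inP => a aS; apply/forall_inP => b bS; apply/implyP.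
by move: aS bS; rewrite !inE => /orP[/orP[]|] /eqP-> /orP[/orP[]|] /eqP->;
  rewrite ?eqxx // => _; rewrite // adj_sym.
Qed.

Lemma part_sub V V' i : V \subset V' -> part V i \subset part V' i.
Proof. by move=> h; apply/subsetP => x; rewrite !inE => /andP[/(subsetP h) -> ->]. Qed.

Lemma card_part_triangle G t i : proper_coloring G -> is_triangle G t -> #|part t i| = 1.
Proof.
move=> pG /is_triangleP[t3 tG].
have inj : {in t &, injective f}.
  move=> x y xt yt fxy; apply/eqP; apply: contraTT isT => xy.
  by have := pG _ _ (tG x y xt yt xy); rewrite fxy eqxx.
have : i \in f @: t.
  have /eqP -> : f @: t == setT by rewrite eqEcard subsetT cardsT card_ord card_in_imset // t3.
  by rewrite inE.
case/imsetP=> x xt ->; apply/eqP/cards1P; exists x; apply/setP => y; rewrite !inE.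
apply/andP/eqP => [[yt /eqP fyx]|->]; last by rewrite xt.
exact: inj.
Qed.

Definition triangle_family G V P :=
  trivIset P && [forall t in P, (t \subset V) && is_triangle G t].

Lemma triangle_familyP G V P :
  reflect (trivIset P /\ forall t, t \in P -> t \subset V /\ is_triangle G t)
          (triangle_family G V P).
Proof.
apply: (iffP andP) => -[h1 h2]; split => //; first by move=> t /(forall_inP h2)/andP.
by apply/forall_inP => t /h2[-> ->].
Qed.

Lemma triangle_family_sub G V V' P P' : P' \subset P -> V \subset V' ->
  triangle_family G V P -> triangle_family G V' P'.
Proof.
move=> PP VV /triangle_familyP[tP hP]; apply/triangle_familyP; split.
  exact: trivIsetS tP.
by move=> t /(subsetP PP)/hP[tV tG]; rewrite (subset_trans tV VV).
Qed.

Lemma triangle_family_cover G V P : triangle_family G V P -> cover P \subset V.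
Proof. by case/triangle_familyP=> _ hP; apply/bigcupsP => t /hP[]. Qed.

Lemma card_part_cover G V P i : proper_coloring G -> triangle_family G V P ->
  #|part (cover P) i| = #|P|.
Proof.
move=> pG /triangle_familyP[tP hP]; rewrite -sum1dep_card big_trivIset_cond //=.
rewrite -sum1_card; apply: eq_bigr => t /hP[_ tt].
by rewrite sum1dep_card (card_part_triangle i pG tt).
Qed.

Lemma triangle_familyU1 G V P t : triangle_family G V P -> t \subset V ->
  is_triangle G t -> [disjoint t & cover P] ->
  triangle_family G V (t |: P) /\ #|t |: P| = #|P|.+1.
Proof.
move=> /triangle_familyP[tP hP] tV tt dt.
have [] := @trivIsetU1 T t P => //.
- by move=> B BP; apply: disjointWr dt; exact: bigcup_sup.
- by apply/negP => /hP[_ /andP[]]; rewrite cards0.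
move=> tU tnP; rewrite cardsU1 tnP; split => //.
apply/triangle_familyP; split => // t'; rewrite !inE => /orP[/eqP->//|]; exact: hP.
Qed.

Lemma triangle_family0 G V : triangle_family G V set0.
Proof.
apply/triangle_familyP; split; last by move=> t; rewrite inE.
by apply/trivIsetP => A B; rewrite inE.
Qed.

Lemma triangle_family_card G V P m : triangle_family G V P -> m <= #|P| ->
  exists2 P', triangle_family G V P' & #|P'| = m.
Proof.
move=> hP /card_geqP[s [us sm sP]]; exists [set x in s].
  by apply: triangle_family_sub hP => //; apply/subsetP => x; rewrite inE => /sP.
by rewrite cardsE (card_uniqP us).
Qed.

(** Among the covered vertices of two parts, the [hi + hj] exceptional ones cost [k] each, the
    others cost 1 each, besides the [wi * wj] pairs between them. Writing [k = hi + hj + e], the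
    quadratic terms are at most [k ^ 2 + hi * hj], hence at most 5/4 of [k ^ 2] by AM-GM. *)
Lemma deletion_count (k t hi hj wi wj : nat) :
  hi + wi = t -> hj + wj = t -> hi + hj <= t -> t <= k ->
  4 * (wi * wj + (k * hi + wi) + (k * hj + wj)) <= 5 * k ^ 2 + 8 * k.
Proof.
move=> ei ej hij tk.
have [e ke] : exists e, k = hi + hj + e by exists (k - hi - hj); lia.
have : wi * wj <= (hj + e) * (hi + e) by apply: leq_mul; lia.
have [agm _] := nat_AGM2 hi hj; rewrite -mulnn in agm.
have : (hi + hj) * (hi + hj) <= k * k by apply: leq_mul; lia.
have : (hj + e) * (hi + e) + (k * hi + k * hj) = k * k + hi * hj by rewrite ke; lia.
by rewrite -mulnn; lia.
Qed.

End Families.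

(** * Destroying all triangles when no vertex is rich *)

Section Deletion.
Local Open Scope nat_scope.
Variables (T : finType) (f : T -> 'I_3) (G : sgraph T).
Hypothesis pG : proper_coloring f G.
Implicit Types (V S t : {set T}) (P : {set {set T}}).

Definition hits V v S :=
  [forall t : {set T},
     [&& t \subset V, is_triangle G t & v \in t] ==> ((t :\ v) :&: S != set0)].

(* A vertex v is rich when no S satisfies few_at V v k S: k disjoint triangles
   avoiding v have only k vertices in each part, so they miss some triangle
   through v and can be extended by it. *)
Definition few_at V v k S := [forall j, #|part f S j| <= k] && hits V v S.

Lemma hitsP V v S t : hits V v S -> t \subset V -> is_triangle G t -> v \in t ->
  exists2 x, x \in t & (x != v) && (x \in S).
Proof.
move=> /forallP/(_ t)/implyP h tV tt vt.
have /set0Pn[x] := h (introT and3P (And3 tV tt vt)).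
by rewrite !inE => /andP[/andP[xv xt] xS]; exists x => //; rewrite xv.
Qed.

Lemma part_setD1_le1 t v j : is_triangle G t -> #|part f (t :\ v) j| <= 1.
Proof.
by move=> tt; rewrite -(card_part_triangle j pG tt) subset_leq_card // part_sub // subD1set.
Qed.

Definition deleted (W : {set T}) (D : T -> {set T}) : rel T :=
  fun x y => [|| (x \in W) && (y \in W), y \in D x | x \in D y].

Definition delete (W : {set T}) (D : T -> {set T}) : sgraph T.
Proof.
exists (fun x y => G x y && ~~ deleted W D x y) => [x y|x].
  by rewrite adj_sym /deleted (andbC (x \in W)) (orbC (y \in D x)).
by rewrite adj_irr.
Defined.

Lemma nonedges_delete V W D i j :
  #|nonedges (delete W D) (part f V i) (part f V j)| <=
  #|nonedges G (part f V i) (part f V j)| +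
  (#|part f W i| * #|part f W j| +
   \sum_(x in part f V i) #|part f (D x) j| + \sum_(x in part f V j) #|part f (D x) i|).
Proof.
set Vi := part f V i; set Vj := part f V j.
pose S1 := setX (part f W i) (part f W j).
pose S2 := [set p in setX Vi Vj | p.2 \in D p.1].
pose S3 := [set p in setX Vj Vi | p.2 \in D p.1].
pose sw (p : T * T) := (p.2, p.1).
have sub : nonedges (delete W D) Vi Vj \subset nonedges G Vi Vj :|: (S1 :|: S2 :|: sw @: S3).
  apply/subsetP => -[x y]; rewrite !inE /= => /andP[/andP[/andP[xV xi] /andP[yV yj]]].
  rewrite negb_and negbK; case: (G x y); rewrite ?xV ?xi ?yV ?yj //=.
  case/or3P=> [/andP[-> ->]||] //=; first by move=> ->; rewrite !orbT.
  move=> h; apply/orP; right; apply/imsetP; exists (y, x) => //.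
  by rewrite !inE /= xV xi yV yj h.
apply: (leq_trans (subset_leq_card sub)); apply: (leq_trans (leq_card_setU _ _)).
rewrite leq_add2l; apply: (leq_trans (leq_card_setU _ _)); apply: leq_add.
  apply: (leq_trans (leq_card_setU _ _)); rewrite cardsX leq_add2l.
  rewrite (card_setX_rel (fun x y => y \in D x)).
  apply: leq_sum => x _; apply: subset_leq_card; apply/subsetP => y.
  by rewrite !inE => /andP[/andP[_ ->] ->].
apply: (leq_trans (leq_imset_card _ _)).
rewrite (card_setX_rel (fun x y => y \in D x)).
apply: leq_sum => x _; apply: subset_leq_card; apply/subsetP => y.
by rewrite !inE => /andP[/andP[_ ->] ->].
Qed.

(** The first hypothesis says that no vertex is rich. The factor 4 keeps the AM-GM bound of
    [deletion_count] within the integers. *)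
Lemma destroy_triangles V k :
  (forall v, v \in V -> exists S, few_at V v k S) ->
  (forall P, triangle_family G V P -> #|P| <= k) ->
  exists G' : sgraph T,
    [/\ forall x y, G' x y -> G x y,
        forall t, t \subset V -> ~~ is_triangle G' t &
        forall i j, i != j ->
          4 * #|nonedges G' (part f V i) (part f V j)| <=
          4 * #|nonedges G (part f V i) (part f V j)| + (5 * k ^ 2 + 8 * k)].
Proof.
move=> few bound.
pose P := [arg max_(P > set0 | triangle_family G V P) #|P|].
have [hP maxP] : triangle_family G V P /\ forall Q, triangle_family G V Q -> #|Q| <= #|P|.
  by rewrite /P; case: arg_maxnP => [|Q hQ mQ]; [exact: triangle_family0 | split].
have /triangle_familyP[tP triP] := hP.
set F := cover P.
have FV : F \subset V := triangle_family_cover hP.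
pose H := V :\: F.
(* Apart from the edges inside [W], deletions are made only at vertices of [N]. When a member has a
   single vertex in [N] no exchange is available: that vertex goes to [Hv] and is treated with its
   [few_at] set, at a cost of up to [k] per part. Any other covered vertex costs at most 1 per
   part. *)
pose N := [set v in F | [exists t, [&& is_triangle G t, v \in t & t :\ v \subset H]]].
pose Hv := [set v in N | N :&: pblock P v == [set v]].
pose W := F :\: Hv.
have HvF : Hv \subset F by apply/subsetP => v; rewrite !inE => /andP[/andP[]].
(* For v in N but not in Hv, another vertex u of the member containing v has a
   triangle tu with two uncovered vertices. A triangle at v with two uncovered
   vertices must meet tu, or the member could be exchanged for both. *)
have exD v : exists D : {set T}, [/\ v \in Hv -> few_at V v k D,
    (v \in W -> (forall j, #|part f D j| <= 1) /\
      forall t, is_triangle G t -> v \in t -> t :\ v \subset H ->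
        exists2 x, x \in t & (x != v) && (x \in D)) &
    v \notin F -> D = set0].
  have [vHv|vHv] := boolP (v \in Hv).
    have vF := subsetP HvF _ vHv.
    have [D hD] := few v (subsetP FV _ vF); exists D; split => //; last by rewrite vF.
    by rewrite inE vHv.
  have [vF|vF] := boolP (v \in F); last first.
    by exists set0; split => //; rewrite inE (negPf vF) andbF.
  have [vN|vN] := boolP (v \in N); last first.
    exists set0; split=> // _; split=> [j|t tt vt tH].
      by rewrite (_ : part f set0 j = set0) ?cards0 //; apply/setP => x; rewrite !inE.
    case/negP: vN; rewrite inE vF; apply/existsP; exists t; exact/and3P.
  have vb : v \in pblock P v by rewrite mem_pblock.
  have bP : pblock P v \in P by rewrite pblock_mem.
  have [u uN /andP[ub uv]] : exists2 u, u \in N & (u \in pblock P v) && (u != v).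
    move: vHv; rewrite inE vN /= eqEsubset sub1set inE vN vb !andbT => /subsetPn[u].
    by rewrite !inE => /andP[uN ub] uv; exists u; rewrite ?inE // ub.
  move: (uN); rewrite inE => /andP[uF /existsP[tu /and3P[ttu utu tuH]]].
  exists (tu :\ u); split=> // _; split=> [j|t tt vt tH]; first exact: part_setD1_le1.
  have [/exists_inP[x xt /andP[xv xD]]|] := boolP [exists x in t, (x != v) && (x \in tu :\ u)].
    by exists x => //; rewrite xv.
  rewrite negb_exists_in => /forall_inP nx.
  have subV w (s : {set T}) : w \in F -> w \in s -> s :\ w \subset H -> s \subset V.
    move=> wF ws sH; rewrite -(setD1K ws) subUset sub1set (subsetP FV) //=.
    by apply: subset_trans sH _; exact: subsetDl.
  have notF w (s : {set T}) x : s :\ w \subset H -> x \in s -> x != w -> x \notin F.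
    move=> sH xs xw; have /(subsetP sH) : x \in s :\ w by rewrite !inE xw.
    by rewrite inE => /andP[].
  pose P1 := P :\ pblock P v.
  have P1F x : x \in cover P1 -> x \in F /\ x \notin pblock P v.
    case/bigcupP=> B; rewrite !inE => /andP[Bb BP] xB; split.
      by apply/bigcupP; exists B.
    apply: contra Bb => xb; apply/eqP.
    by rewrite -(def_pblock tP BP xB) (def_pblock tP bP xb).
  have hP1 : triangle_family G V P1 by apply: triangle_family_sub hP => //; exact: subD1set.
  have [|hP2 cP2] := triangle_familyU1 hP1 (subV _ _ uF utu tuH) ttu.
    rewrite -setI_eq0 -subset0; apply/subsetP => x; rewrite inE => /andP[xtu /P1F[xF xb]].
    have [xu|xu] := eqVneq x u; first by rewrite xu ub in xb.
    by have := notF _ _ _ tuH xtu xu; rewrite xF.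
  have [|hP3 cP3] := triangle_familyU1 hP2 (subV _ _ vF vt tH) tt.
    rewrite -setI_eq0 -subset0; apply/subsetP => x; rewrite inE => /andP[xt].
    rewrite /cover bigcup_setU big_set1 inE -/(cover P1); case/orP=> [xtu|/P1F[xF xb]].
      have [xv|xv] := eqVneq x v.
        by have := notF _ _ _ tuH xtu; rewrite xv eq_sym uv vF => /(_ isT).
      have := nx x xt; rewrite xv !inE xtu andbT /= negbK => /eqP xu.
      by have := notF _ _ _ tH xt xv; rewrite xu uF.
    have [xv|xv] := eqVneq x v; first by rewrite xv vb in xb.
    by have := notF _ _ _ tH xt xv; rewrite xF.
  have := maxP _ hP3; rewrite cP3 cP2 (cardsD1 (pblock P v) P) bP add1n -/P1.
  by rewrite ltnn.
have [D hD] := fin_all_exists exD.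
exists (delete W D); split.
- by move=> x y /andP[].
- move=> t tV; apply/negP => tt'.
  have tt : is_triangle G t.
    case/is_triangleP: tt' => t3 tE; apply/is_triangleP; split=> // x y xt yt xy.
    by have /andP[] := tE x y xt yt xy.
  have nd x y : x \in t -> y \in t -> x != y -> ~~ deleted W D x y.
    move=> xt yt xy; case/is_triangleP: tt' => _ tE.
    by have /andP[] := tE x y xt yt xy.
  have hit v : v \in t -> ~ exists2 x, x \in t & (x != v) && (x \in D v).
    by move=> vt [x xt /andP[xv xD]]; have := nd x v xt vt xv; rewrite /deleted xD !orbT.
  (* A surviving triangle avoids [Hv], as [D v] hits all triangles through such a [v]. If it meets
     [F], it does so in a single vertex of [W], edges inside [W] being deleted, and [D v] hits it
     again. If it misses [F], it enlarges the maximum family. *)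
  have [/exists_inP[v vt vHv]|] := boolP [exists v in t, v \in Hv].
    have [/(_ vHv) /andP[_ h] _ _] := hD v.
    exact: (hit _ vt (hitsP h tV tt vt)).
  rewrite negb_exists_in => /forall_inP tHv.
  have [/exists_inP[v vt vF]|] := boolP [exists v in t, v \in F].
    have vW : v \in W by rewrite inE tHv.
    have [_ /(_ vW) [_ h] _] := hD v.
    apply: (hit _ vt (h _ tt vt _)); apply/subsetP => x; rewrite !inE => /andP[xv xt].
    rewrite (subsetP tV) // andbT; apply/negP => xF.
    by have := nd x v xt vt xv; rewrite /deleted vW inE xF tHv.
  rewrite negb_exists_in => /forall_inP tF.
  have [|hP' cP'] := triangle_familyU1 hP tV tt.
    by rewrite -setI_eq0 -subset0; apply/subsetP => x; rewrite inE => /andP[/tF/negPf ->].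
  by have := maxP _ hP'; rewrite cP' ltnn.
- move=> i j ij.
  have sumD (a b : 'I_3) :
      \sum_(x in part f V a) #|part f (D x) b| <= k * #|part f Hv a| + #|part f W a|.
    apply: (@leq_trans (\sum_(x in part f V a) (k * (x \in Hv) + (x \in W)))).
      apply: leq_sum => x _; have [d1 d2 d3] := hD x.
      have [xHv|xHv] := boolP (x \in Hv).
        by rewrite muln1; have /andP[/forallP/(_ b) h _] := d1 xHv; rewrite (leq_trans h) ?leq_addr.
      rewrite muln0 add0n; have [xF|xF] := boolP (x \in F).
        have xW : x \in W by rewrite inE xHv xF.
        by rewrite xW; case: (d2 xW).
      rewrite d3 // (_ : part f set0 b = set0) ?cards0 //.
      by apply/setP => y; rewrite !inE.
    have cnt (S : {set T}) : \sum_(x in part f V a) (x \in S) <= #|part f S a|.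
      rewrite -sum1_card big_mkcond [X in _ <= X]big_mkcond; apply: leq_sum => x _.
      by rewrite !inE; case: (x \in S); case: (x \in V); case: (f x == a).
    by rewrite big_split -big_distrr /= leq_add // leq_mul2l cnt orbT.
  have cF (a : 'I_3) : #|part f Hv a| + #|part f W a| = #|P|.
    rewrite -(card_part_cover a pG hP) -/F -(cardsID Hv (part f F a)).
    congr (_ + _); apply: eq_card => x.
      rewrite !inE; have := subsetP HvF x; rewrite !inE.
      by case: (_ && _) => /= [->|_]; rewrite ?andbT ?andbF.
    rewrite !inE; by rewrite andbA.
  (* Each member of [P] contains at most one vertex of [Hv], so [pblock P] is injective there. *)
  have cHv : #|part f Hv i| + #|part f Hv j| <= #|P|.
    have -> : #|part f Hv i| + #|part f Hv j| = #|part f Hv i :|: part f Hv j|.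
      rewrite cardsU (_ : _ :&: _ = set0) ?cards0 ?subn0 //; apply/setP => x.
      rewrite [LHS]inE [LHS]andbC !inE; apply/negP => /andP[/andP[_ /eqP->] /andP[_ /eqP ji]].
      by rewrite ji eqxx in ij.
    apply: (@leq_trans #|Hv|).
      by apply: subset_leq_card; apply/subsetP => x; rewrite !inE => /orP[] /andP[].
    have inj : {in Hv &, injective (pblock P)}.
      move=> x y; rewrite !inE => /andP[_ /eqP hx] /andP[_ /eqP hy] e.
      by apply: set1_inj; rewrite -hx -hy e.
    rewrite -(card_in_imset inj); apply: subset_leq_card; apply/subsetP => B /imsetP[x xHv ->].
    by rewrite pblock_mem // (subsetP HvF).
  have := nonedges_delete V W D i j.
  have := deletion_count (cF i) (cF j) cHv (bound _ hP).
  have := sumD i j; have := sumD j i; lia.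
Qed.
End Deletion.

(** * Disjoint triangles *)

(* n - p, n - q, n - r are the sizes of the parts after the removal of p, q, r
   rich vertices, k = s - p - q - r is the number of removals still allowed, and
   M bounds the number of non-edges between two parts of the remaining graph
   once its triangles have been destroyed. The second conclusion is
   al * be + ga > 1 for the densities 1 - M / ((n - p) * (n - q)), etc. *)
Lemma deletion_budget (R : realFieldType) (n s d k p q r : R) :
  0 <= p -> 0 <= q -> 0 <= r -> (k = 0 \/ 1 <= k) -> p + q + r + k = s ->
  5 * s + 7 <= n -> 0 < d -> d <= 1 -> n < n * d ^+ 2 + (n - s) * d ->
  let M := (1 - d) * n ^+ 2 + (5 * k ^+ 2 + 8 * k) / 4 in
  M <= (n - p) * (n - q) /\
  0 < (n - p) ^+ 2 * (n - q) * (n - r) -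
      M * (n - p) * ((n - p) + (n - q) + (n - r)) + M ^+ 2.
Proof.
move=> p0 q0 r0 k01 Es sn d0 d1 hd.
have k0 : 0 <= k by case: k01 => [->|]; lra.
have s0 : 0 <= s by lra.
have n0 : 0 < n by lra.
have nW := ltW n0.
have dW := ltW d0.
(* At 3/5 the value of [d ^+ 2 + d] is only 24/25, while [hd] forces it above 1. *)
have d35 : 3 / 5 < d.
  rewrite ltNge; apply/negP => h.
  have e1 : (n - s) * d <= n * d by rewrite ler_wpM2r; lra.
  have : n * (d ^+ 2 + d) <= n * (24 / 25).
    rewrite ler_wpM2l // expr2.
    have : d * d <= 3 / 5 * (3 / 5) by rewrite ler_pM //; exact: ltW.
    lra.
  rewrite mulrDr; lra.
set D := (5 * k ^+ 2 + 8 * k) / 4.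
have kk : 0 <= k ^+ 2 by rewrite exprn_ge0.
have D0 : 0 <= D by rewrite /D; lra.
set mu := (1 - d) * n ^+ 2.
have mu0 : 0 <= mu by rewrite mulr_ge0 ?exprn_ge0; lra.
move=> M.
have N0 : 0 < n - p by lra.
have NW := ltW N0.
have kn : k * (5 * k + 7) <= k * n by rewrite ler_wpM2l //; lra.
have pn : (n - p) <= n by lra.
split.
  have : n * (n - s + k) <= (n - p) * (n - q).
    have : 0 <= p * q by rewrite mulr_ge0.
    have : 0 <= r * n by rewrite mulr_ge0//.
    rewrite -Es; lra.
  have : s * (5 * s + 7) <= s * n by rewrite ler_wpM2l //; lra.
  have sn5 : s * n <= n * n / 5.
    have : 5 * s * n <= n * n by rewrite ler_wpM2r //; lra.
    lra.
  have m1 : mu <= 2 / 5 * n ^+ 2 by rewrite /mu ler_wpM2r ?exprn_ge0 //; lra.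
  have : D <= 2 * (k * n) / 4.
    rewrite /D; rewrite !expr2 in kk *; lra.
  have : k * n <= s * n by rewrite ler_wpM2r //; lra.
  have : 0 <= k * n by rewrite mulr_ge0 .
  rewrite /M expr2 in m1 *; lra.
have E1 : (n - p) * (n ^+ 2 * (n - s + k)) <= (n - p) ^+ 2 * (n - q) * (n - r).
  have a1 : n * (n - s + k + p) <= (n - q) * (n - r).
    have : 0 <= q * r by rewrite mulr_ge0.
    rewrite -Es; lra.
  have a2 : n * (n - s + k) <= (n - p) * (n - s + k + p).
    have : 0 <= p * (s - k - p) by rewrite mulr_ge0 //; lra.
    lra.
  rewrite (expr2 (n - p)) -!mulrA ler_pM2l //.
  have : n * (n * (n - s + k)) <= n * ((n - p) * (n - s + k + p)) by rewrite ler_wpM2l//.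
  have : (n - p) * (n * (n - s + k + p)) <= (n - p) * ((n - q) * (n - r)) by rewrite ler_wpM2l//.
  lra.
set Z := (n - p) + (n - q) + (n - r).
have ZE : Z = 3 * n - s + k by rewrite /Z -Es; ring.
(* The extreme case [k = 0], [D = 0]. After multiplication by [n], the hypothesis [hd] appears as a
   factor, up to the nonnegative term [p * mu ^+ 2]. *)
have E2 : 0 < (n - p) * (n ^+ 2 * (n - s)) - mu * (n - p) * (3 * n - s) + mu ^+ 2.
  rewrite -(pmulr_rgt0 _ n0).
  have -> : n * ((n - p) * (n ^+ 2 * (n - s)) - mu * (n - p) * (3 * n - s) + mu ^+ 2) =
    (n - p) * n ^+ 3 * (n * d ^+ 2 + (n - s) * d - n) + p * mu ^+ 2 by rewrite /mu; ring.
  apply: ltr_wpDr; first by rewrite mulr_ge0 ?exprn_ge0.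
  by rewrite !mulr_gt0 ?exprn_gt0 ?subr_gt0 //; lra.
(* The [k] removals not made improve the case of [E2] by [(n - p) * k * d * n ^+ 2], and this pays
   for the term linear in [D]. *)
have E3 : D * ((n - p) * Z - 2 * mu) <= (n - p) * k * d * n ^+ 2.
  have : (n - p) * Z - 2 * mu <= (n - p) * n * (1 + 2 * d).
    have : (n - p) * Z <= (n - p) * (3 * n) by rewrite ler_wpM2l // ZE; lra.
    have : (1 - d) * n * (n - p) <= (1 - d) * n * n by rewrite ler_wpM2l // mulr_ge0 // ; lra.
    rewrite /mu expr2; lra.
  move/(ler_wpM2l D0) => h; apply: (le_trans h).
  have : D * (1 + 2 * d) <= k * d * n.
    case: k01 => [k00|k1]; first by rewrite /D k00; lra.
    (* Here [n >= 5 s + 7] is spent: [10 k + 12] is [4 (5 k + 7) - 2 (5 k + 8)]. With [d > 3/5] the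
       estimate needs [6 k + 36/5 >= 5 k + 8], which holds from [k = 1] on; hence the case split on
       [k]. *)
    have : k * (5 * k + 8) <= k * (d * (10 * k + 12)).
      rewrite ler_wpM2l //.
      have : 3 / 5 * (10 * k + 12) <= d * (10 * k + 12) by rewrite ler_wpM2r //; lra.
      lra.
    have : d * (k * (5 * k + 7)) <= d * (k * n) by rewrite ler_wpM2l//.
    rewrite /D expr2; lra.
  move=> h2.
  have : (n - p) * n * (D * (1 + 2 * d)) <= (n - p) * n * (k * d * n).
    by rewrite ler_wpM2l // mulr_ge0//.
  rewrite expr2; lra.
have -> : M = mu + D by [].
have D2 : 0 <= D ^+ 2 by rewrite exprn_ge0.
have -> : (n - p) ^+ 2 * (n - q) * (n - r) - (mu + D) * (n - p) * Z + (mu + D) ^+ 2 =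
 ((n - p) ^+ 2 * (n - q) * (n - r) - (n - p) * (n ^+ 2 * (n - s + k))) +
 ((n - p) * (n ^+ 2 * (n - s)) - mu * (n - p) * (3 * n - s) + mu ^+ 2) +
 ((n - p) * k * d * n ^+ 2 - D * ((n - p) * Z - 2 * mu)) + D ^+ 2.
  rewrite ZE /mu; ring.
lra.
Qed.

Section Main.
Variables (R : rcfType) (T : finType).

Lemma card_edges_nonedges (G : sgraph T) (U W : {set T}) :
  (#|edges_between G U W| + #|nonedges G U W| = #|U| * #|W|)%N.
Proof.
rewrite -cardsX -(cardsID (edges_between G U W) (setX U W)).
congr (_ + _)%N; apply: eq_card => p; rewrite !inE.
all: by case: (p.1 \in U); case: (p.2 \in W); case: (G p.1 p.2).
Qed.

(** Each density is at least 1 minus [M] over the product of the part sizes. The bounds such as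
    [M <= a * b] make these lower bounds nonnegative, so that they may be multiplied; the last three
    hypotheses are the density conditions with denominators cleared. *)
Lemma triangle_of_few_nonedges (G : sgraph T) (A B C : {set T}) (M : R) :
  let a := #|A|%:R : R in let b := #|B|%:R : R in let c := #|C|%:R : R in
  0 < a -> 0 < b -> 0 < c -> M <= a * b -> M <= a * c -> M <= b * c ->
  #|nonedges G A B|%:R <= M -> #|nonedges G A C|%:R <= M ->
  #|nonedges G B C|%:R <= M ->
  0 < a ^+ 2 * b * c - M * a * (a + b + c) + M ^+ 2 ->
  0 < b ^+ 2 * a * c - M * b * (a + b + c) + M ^+ 2 ->
  0 < c ^+ 2 * a * b - M * c * (a + b + c) + M ^+ 2 ->
  exists x y z, [/\ x \in A, y \in B, z \in C & [/\ G x y, G x z & G y z]].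
Proof.
move=> a b c a0 b0 c0 Mab Mac Mbc nAB nAC nBC hA hB hC.
have dens (U W : {set T}) : 0 < #|U|%:R * #|W|%:R :> R -> #|nonedges G U W|%:R <= M ->
    1 - M / (#|U|%:R * #|W|%:R) <= pair_density R G U W.
  move=> p le; rewrite /pair_density ler_pdivlMr // mulrBl mul1r mulfVK ?gt_eqF //.
  by rewrite -natrM -(card_edges_nonedges G) natrD; lra.
have ab := mulr_gt0 a0 b0; have ac := mulr_gt0 a0 c0; have bc := mulr_gt0 b0 c0.
have dAB := dens _ _ ab nAB; have dAC := dens _ _ ac nAC; have dBC := dens _ _ bc nBC.
have nn (x : R) : 0 < x -> M <= x -> 0 <= 1 - M / x.
  by move=> x0 Mx; rewrite subr_ge0 ler_pdivrMr // mul1r.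
have key (x y z : R) : 0 < x -> 0 < y -> 0 < z ->
    0 < x ^+ 2 * y * z - M * x * (x + y + z) + M ^+ 2 ->
    1 < (1 - M / (x * y)) * (1 - M / (x * z)) + (1 - M / (y * z)).
  move=> x0 y0 z0 h; rewrite -subr_gt0.
  have -> : (1 - M / (x * y)) * (1 - M / (x * z)) + (1 - M / (y * z)) - 1 =
     (x ^+ 2 * y * z - M * x * (x + y + z) + M ^+ 2) / (x ^+ 2 * y * z).
    by field; rewrite !gt_eqF.
  by rewrite divr_gt0 // !mulr_gt0 ?exprn_gt0.
apply: (@dense_triangle R).
- apply: lt_le_trans (lerD (ler_pM (nn _ ab Mab) (nn _ ac Mac) dAB dAC) dBC).
  exact: key.
- apply: lt_le_trans (lerD (ler_pM (nn _ ab Mab) (nn _ bc Mbc) dAB dBC) dAC).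
  by rewrite (mulrC #|A|%:R #|B|%:R); apply: key => //; rewrite (addrC b a).
- apply: lt_le_trans (lerD (ler_pM (nn _ ac Mac) (nn _ bc Mbc) dAC dBC) dAB).
  by rewrite (mulrC #|A|%:R #|C|%:R) (mulrC #|B|%:R #|C|%:R); apply: key => //;
     rewrite (addrC c a) (addrAC a c b).
Qed.

Variable f : T -> 'I_3.
Variables (n s : nat) (d : R).
Hypothesis sn : (5 * s + 7 <= n)%N.
Hypothesis d0 : 0 < d.
Hypothesis d1 : d <= 1.
Hypothesis hd : n%:R < n%:R * d ^+ 2 + (n%:R - s%:R) * d.

Lemma ord3E (i : 'I_3) : [\/ i = 0%R, i = 1%R | i = 2%:R].
Proof.
by case: i => [[|[|[|m]]] h]; [apply: Or31 | apply: Or32 | apply: Or33 | ]; try exact: val_inj.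
Qed.

(** [p i] counts the vertices removed from part [i]. [deletion_budget] is not symmetric in the
    parts, so it is applied with each of them in first place. *)
Lemma find_triangle (G : sgraph T) (V : {set T}) (p : 'I_3 -> nat) k :
  (\sum_i p i + k = s)%N ->
  (forall i, (#|part f V i| + p i = n)%N) ->
  (forall i j, i != j -> #|nonedges G (part f V i) (part f V j)|%:R <=
     (1 - d) * n%:R ^+ 2 + (5 * k%:R ^+ 2 + 8 * k%:R) / 4) ->
  exists2 t : {set T}, t \subset V & is_triangle G t.
Proof.
move=> sp cV miss.
have E : (p 0%R + p 1%R + p 2%:R + k = s)%N.
  rewrite -sp !big_ord_recl big_ord0 addn0 addnA.
  by congr (p _ + p _ + p _ + k)%N; apply: val_inj.
have k01 : k%:R = 0 :> R \/ 1 <= k%:R :> R.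
  by case: (k) => [|m]; [left | right; rewrite ler1n].
have sn' : 5 * s%:R + 7 <= n%:R :> R.
  by rewrite -natrM -natrD ler_nat.
have c i : #|part f V i|%:R = n%:R - (p i)%:R :> R.
  by rewrite -(cV i) natrD addrK.
have c0 i : 0 < #|part f V i|%:R :> R.
  rewrite ltr0n; have := cV i; have := leq_trans (leq_addr k _) (eq_leq E).
  case: (ord3E i) => ->; lia.
set M := _ + _ in miss.
have bud i j l : (p i + p j + p l + k = s)%N ->
    let x := #|part f V i|%:R : R in let y := #|part f V j|%:R : R in
    let z := #|part f V l|%:R : R in
    M <= x * y /\ 0 < x ^+ 2 * y * z - M * x * (x + y + z) + M ^+ 2.
  move=> e; rewrite /= !c; apply: (@deletion_budget R n%:R s%:R) => //.
  by rewrite -!natrD e.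
have [] := @triangle_of_few_nonedges G (part f V 0) (part f V 1) (part f V 2%:R) M.
all: rewrite ?c0 ?miss //.
- by have [] := bud _ _ _ E.
- by have [] := bud 0 2%:R 1; first lia.
- by have [] := bud 1 2%:R 0; first lia.
- by have [] := bud _ _ _ E.
- have [|_] := bud 1 0 2%:R; first lia.
  lra.
- have [|_] := bud 2%:R 0 1; first lia.
  lra.
move=> x [y [z [xA yB zC [xy xz yz]]]].
exists [set x; y; z]; last exact: is_triangle_set3.
move: xA yB zC; rewrite !inE => /andP[xV _] /andP[yV _] /andP[zV _].
by apply/subsetP => w; rewrite !inE => /orP[/orP[]|] /eqP ->.
Qed.

(** Induction on the number [k] of removals still allowed. The bound on non-edges refers to the
    original size [n] and so is inherited after each removal. *)
Lemma exists_family k (G : sgraph T) (V : {set T}) (p : 'I_3 -> nat) :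
  proper_coloring f G ->
  (\sum_i p i + k = s)%N ->
  (forall i, (#|part f V i| + p i = n)%N) ->
  (forall i j, i != j -> #|nonedges G (part f V i) (part f V j)|%:R <=
     (1 - d) * n%:R ^+ 2) ->
  exists2 P, triangle_family G V P & (k < #|P|)%N.
Proof.
move=> pG; elim: k V p => [|k IH] V p sp cV miss.
  have [|t tV tt] := find_triangle sp cV (G := G).
    by move=> i j /miss; rewrite expr0n /=; lra.
  have [|hP cP] := triangle_familyU1 (triangle_family0 G V) tV tt.
    by rewrite /cover big_set0 -setI_eq0 setI0.
  by exists (t |: set0); rewrite // cP.
have [/existsP[P /andP[hP kP]]|none] :=
  boolP [exists P, triangle_family G V P && (k.+1 < #|P|)%N].
  by exists P.
have [/forall_inP few|] := boolP [forall v in V, exists S, few_at f G V v k.+1 S].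
  exfalso.
  have [||G' [sub free del]] := @destroy_triangles T f G pG V k.+1.
  - by move=> v /few /existsP.
  - move=> P hP; rewrite leqNgt; apply: contra none => kP; apply/existsP; exists P.
    by rewrite hP.
  have [|t tV tt] := find_triangle sp cV (G := G'); last by have := free t tV; rewrite tt.
  move=> i j ij; have := miss i j ij; have := del i j ij.
  rewrite -(ler_nat R) !natrD !natrM ?natrX; lra.
rewrite negb_forall_in => /exists_inP[v vV]; rewrite negb_exists => /forallP rich.
have [||| P0 hP0 cP0] := IH (V :\ v) (fun i => p i + (i == f v))%N.
- rewrite big_split /= (_ : (\sum_i (i == f v) = 1)%N) ?addn1 ?addSnnS //.
  by rewrite (bigD1 (f v)) //= eqxx big1 // => i /negPf->.
- move=> i; rewrite -(cV i) (cardsD1 v (part f V i)) !inE vV eq_sym /=.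
  rewrite (_ : part f (V :\ v) i = part f V i :\ v); first by lia.
  by apply/setP => x; rewrite !inE andbA.
- move=> i j /miss; apply: le_trans; rewrite ler_nat subset_leq_card //.
  apply/subsetP => x; rewrite !inE.
  by case/andP=> /andP[/andP[/andP[_ ->] ->] /andP[/andP[_ ->] ->]] ->.
(* With exactly [k.+1] members, [cover P] respects the size bound in [few_at]; since [v] is rich,
   some triangle through [v] must then avoid it. *)
have [P hP cP] := triangle_family_card hP0 cP0.
have := rich (cover P); rewrite negb_and => /orP[|].
  rewrite negb_forall => /existsP[j].
  by rewrite (card_part_cover j pG hP) cP leqnn.
rewrite negb_forall => /existsP[t]; rewrite negb_imply negbK.
case/andP=> /and3P[tV tt vt] /eqP dis.
have hPV : triangle_family G V P by apply: triangle_family_sub hP => //; exact: subD1set.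
have [|hP' cP'] := triangle_familyU1 hPV tV tt.
  rewrite -setI_eq0 -subset0 -dis; apply/subsetP => x; rewrite !inE => /andP[xt xP].
  rewrite xt xP !andbT; have := subsetP (triangle_family_cover hP) x xP.
  by rewrite !inE => /andP[].
by exists (t |: P); rewrite // cP' cP.
Qed.
End Main.

Lemma card_nonedgesC (T : finType) (G : sgraph T) (U W : {set T}) :
  #|nonedges G U W| = #|nonedges G W U|.
Proof.
have inj : injective (fun p : T * T => (p.2, p.1)) by move=> [a b] [c e] [-> ->].
rewrite -(card_imset _ inj); apply: eq_card => -[x y]; apply/imsetP/idP => [[[a b]]|].
  by rewrite !inE /= => /andP[/andP[aU bW] nab] [-> ->]; rewrite bW aU adj_sym.
rewrite !inE /= => /andP[/andP[xW yU] nxy]; exists (y, x) => //.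
by rewrite !inE /= xW yU adj_sym.
Qed.

Theorem corollary1p4 (R : rcfType) (n k : nat) (T : finType) (G : sgraph T)
    (A B C : {set T}) (tau : R)
    (hk : (2 <= k)%N) (hn : (5 * k + 2 <= n)%N)
    (hG : tripartite G A B C)
    (hA : #|A| = n) (hB : #|B| = n) (hC : #|C| = n)
    (htau : is_tau k n tau)
    (hd : tau < bip_density R G A B C) :
  has_disjoint_triangles G k.
Proof.
case: hG => cov [dAB dAC dBC] [iA iB iC]; case: htau => t0 tauE.
set d := bip_density R G A B C in hd.
have [pAB pAC pBC] : [/\ d <= pair_density R G A B, d <= pair_density R G A C &
    d <= pair_density R G B C].
  by rewrite /d /bip_density !ge_min !lexx !orbT.
have d1 : d <= 1 := le_trans pAB (pair_density_le1 _ _ _ _).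
have d0 : 0 < d := lt_trans t0 hd.
(* In terms of [s = k - 1], the bound [5 k + 2] is [5 s + 7] and the coefficient [n + 1 - k] is
   [n - s]. *)
have [s ks] : exists s, k = s.+1 by exists k.-1; rewrite prednK // ltnW.
have sn : (5 * s + 7 <= n)%N by rewrite ks in hn; clear -hn; lia.
have n0 : 0 < n%:R :> R by rewrite ltr0n; clear -sn; lia.
(* As [n - s > 0], the quadratic defining [tau] increases on the positive axis, so it is positive at
   [d]. *)
have hds : n%:R < n%:R * d ^+ 2 + (n%:R - s%:R) * d.
  have sn0 : 0 < n%:R - s%:R :> R by rewrite subr_gt0 ltr_nat; clear -sn; lia.
  have : n%:R * tau ^+ 2 < n%:R * d ^+ 2.
    by rewrite ltr_pM2l // ltr_pXn2r // nnegrE ltW.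
  have : (n%:R - s%:R) * tau < (n%:R - s%:R) * d by rewrite ltr_pM2l.
  by move: tauE; rewrite ks -natr1; lra.
have few (U W : {set T}) : #|U| = n -> #|W| = n -> d <= pair_density R G U W ->
    #|nonedges G U W|%:R <= (1 - d) * n%:R ^+ 2.
  move=> cU cW; have := card_edges_nonedges G U W.
  rewrite /pair_density cU cW => /(congr1 (fun m => m%:R : R)).
  by rewrite natrD natrM ler_pdivlMr ?mulr_gt0 // expr2; lra.
pose f x : 'I_3 := if x \in A then 0 else if x \in B then 1 else 2%:R.
have inC x : x \notin A -> x \notin B -> x \in C.
  by move=> /negPf xA /negPf xB; have := in_setT x; rewrite -cov !inE xA xB.
have pA : part f setT 0 = A.
  by apply/setP => x; rewrite !inE /f; case: (x \in A) => //; case: (x \in B).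
have pB : part f setT 1 = B.
  apply/setP => x; rewrite !inE /f; have [xA|_] := boolP (x \in A); last by case: (x \in B).
  by rewrite (disjointFr dAB xA).
have pC : part f setT 2%:R = C.
  apply/setP => x; rewrite !inE /f; have [xA|xA] := boolP (x \in A).
    by rewrite (disjointFr dAC xA).
  by have [xB|xB] := boolP (x \in B); rewrite ?(disjointFr dBC xB) ?inC.
have ind i : independent G (part f setT i).
  by case: (ord3E i) => ->; rewrite ?pA ?pB ?pC.
have pG : proper_coloring f G.
  move=> x y xy; apply/negP => /eqP fxy.
  by have := ind (f y) x y; rewrite !inE fxy eqxx xy => /(_ isT isT).
have fewC (U W : {set T}) : #|U| = n -> #|W| = n -> d <= pair_density R G U W ->
    #|nonedges G W U|%:R <= (1 - d) * n%:R ^+ 2.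
  by move=> cU cW; rewrite card_nonedgesC; exact: few.
have [|||P hP kP] :=
  @exists_family R T f n s d sn d0 d1 hds s G setT (fun=> 0%N) pG.
- by rewrite big1.
- by move=> i; rewrite addn0; case: (ord3E i) => ->; rewrite ?pA ?pB ?pC.
- by move=> i j; case: (ord3E i) => ->; case: (ord3E j) => ->; rewrite ?pA ?pB ?pC //; auto.
have [Q /triangle_familyP[tQ hQ] cQ] := triangle_family_card hP kP.
by exists Q; rewrite cQ ks; split=> // t /hQ[_ /is_triangleP].
Qed.
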